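(* For every real $x \in (0,\pi/2)$, $$\frac{x^2}{\sinh^2 x} < \frac{\sin x}{x} < \frac{x}{\sinh x}.$$
   Context: Here $\sinh^2 x = (\sinh x)^2$. *)

(* Defs.v *)
From Stdlib Require Export Reals.

(* Main.v *)
Require Import Defs.
From Stdlib Require Import Reals Lra.
From Coquelicot Require Import Coquelicot.

Local Open Scope R_scope.

(** Clearing denominators, the two inequalities are [x ^ 3 < sin x * sinh x ^ 2]
    and [sin x * sinh x < x ^ 2].

    For the upper bound, [x ^ 2 - sin x * sinh x] vanishes at [0] together with
    its first three derivatives, and its fourth derivative is
    [4 * (sin x * sinh x)], which is positive on [(0, PI)].  Integrating this sign
    back to the function (through [cosh_mul_cos_lt_1]) gives
    [sin_mul_sinh_lt_sqr].

    For the lower bound, Taylor polynomials suffice: with [u = x ^ 2],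
    [sin x > x * (1 - u / 6)] and [sinh x > x * (1 + u / 6 + u ^ 2 / 120)],
    and [(1 - u / 6) * (1 + u / 6 + u ^ 2 / 120) ^ 2 > 1] for [0 < u < 4].  This
    range contains [(0, (PI / 2) ^ 2)] by the crude bound [PI <= 4].  The
    quintic term of [sinh] is what makes such a crude bound enough: with
    the cubic polynomial, the product falls below [1] before [u = 4]. *)

(** The mean value theorem in the form used to lift the sign of a derivative to
    the function.  Iterated, it integrates a sign through several derivatives. *)
Lemma pos_of_derive_pos (f f' : R -> R) (b : R) :
  f 0 = 0 ->
  (forall t, is_derive f t (f' t)) ->
  (forall t, 0 < t < b -> 0 < f' t) ->
  forall x, 0 < x < b -> 0 < f x.
Proof.
intros f0 df f'pos x [x0 xb].
destruct (MVT_cor2 f f' 0 x x0) as [c [fxE cx]].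
  intros c _; apply is_derive_Reals, df.
assert (c_pos : 0 < f' c) by (apply f'pos; lra).
nra.
Qed.

(** * Taylor lower bounds *)

Lemma cosh_gt_1 x : 0 < x -> 1 < cosh x.
Proof.
intros x0; rewrite <- cosh_0.
unfold cosh; rewrite Ropp_0, exp_0, exp_Ropp.
assert (ex : 1 < exp x) by (pose proof (exp_ineq1 x ltac:(lra)); lra).
assert (sq : exp x + / exp x - 2 = (exp x - 1) ^ 2 / exp x) by (field; lra).
assert (0 < (exp x - 1) ^ 2 / exp x).
  apply Rdiv_lt_0_compat; [apply pow_lt|]; lra.
lra.
Qed.

(** From here on, each bound for [sinh] or [cosh] is the integral of the
    preceding one, since their Taylor polynomials differentiate into each other;
    the same ladder for [sin] and [cos] starts at [sin x < x]. *)
Lemma sinh_gt_id x : 0 < x -> x < sinh x.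
Proof.
intros x0; apply Rlt_0_minus.
apply (pos_of_derive_pos (fun t => sinh t - t) (fun t => cosh t - 1) (x + 1));
  [rewrite sinh_0; ring | | | lra].
- intros t; auto_derive; [easy | ring].
- intros t [t0 _]; pose proof (cosh_gt_1 t t0); lra.
Qed.

Lemma cosh_gt_taylor2 x : 0 < x -> 1 + x ^ 2 / 2 < cosh x.
Proof.
intros x0; apply Rlt_0_minus.
apply (pos_of_derive_pos (fun t => cosh t - (1 + t ^ 2 / 2))
         (fun t => sinh t - t) (x + 1));
  [rewrite cosh_0; field | | | lra].
- intros t; auto_derive; [easy | simpl; field].
- intros t [t0 _]; pose proof (sinh_gt_id t t0); lra.
Qed.

Lemma sinh_gt_taylor3 x : 0 < x -> x + x ^ 3 / 6 < sinh x.
Proof.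
intros x0; apply Rlt_0_minus.
apply (pos_of_derive_pos (fun t => sinh t - (t + t ^ 3 / 6))
         (fun t => cosh t - (1 + t ^ 2 / 2)) (x + 1));
  [rewrite sinh_0; field | | | lra].
- intros t; auto_derive; [easy | simpl; field].
- intros t [t0 _]; pose proof (cosh_gt_taylor2 t t0); lra.
Qed.

Lemma cosh_gt_taylor4 x : 0 < x -> 1 + x ^ 2 / 2 + x ^ 4 / 24 < cosh x.
Proof.
intros x0; apply Rlt_0_minus.
apply (pos_of_derive_pos (fun t => cosh t - (1 + t ^ 2 / 2 + t ^ 4 / 24))
         (fun t => sinh t - (t + t ^ 3 / 6)) (x + 1));
  [rewrite cosh_0; field | | | lra].
- intros t; auto_derive; [easy | simpl; field].
- intros t [t0 _]; pose proof (sinh_gt_taylor3 t t0); lra.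
Qed.

Lemma sinh_gt_taylor5 x : 0 < x -> x + x ^ 3 / 6 + x ^ 5 / 120 < sinh x.
Proof.
intros x0; apply Rlt_0_minus.
apply (pos_of_derive_pos (fun t => sinh t - (t + t ^ 3 / 6 + t ^ 5 / 120))
         (fun t => cosh t - (1 + t ^ 2 / 2 + t ^ 4 / 24)) (x + 1));
  [rewrite sinh_0; field | | | lra].
- intros t; auto_derive; [easy | simpl; field].
- intros t [t0 _]; pose proof (cosh_gt_taylor4 t t0); lra.
Qed.

Lemma cos_gt_taylor2 x : 0 < x -> 1 - x ^ 2 / 2 < cos x.
Proof.
intros x0; apply Rlt_0_minus.
apply (pos_of_derive_pos (fun t => cos t - (1 - t ^ 2 / 2))
         (fun t => t - sin t) (x + 1));
  [rewrite cos_0; field | | | lra].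
- intros t; auto_derive; [easy | simpl; field].
- intros t [t0 _]; pose proof (sin_lt_x t t0); lra.
Qed.

Lemma sin_gt_taylor3 x : 0 < x -> x - x ^ 3 / 6 < sin x.
Proof.
intros x0; apply Rlt_0_minus.
apply (pos_of_derive_pos (fun t => sin t - (t - t ^ 3 / 6))
         (fun t => cos t - (1 - t ^ 2 / 2)) (x + 1));
  [rewrite sin_0; field | | | lra].
- intros t; auto_derive; [easy | simpl; field].
- intros t [t0 _]; pose proof (cos_gt_taylor2 t t0); lra.
Qed.

(** * The lower bound *)

Lemma taylor_product_gt_1 u :
  0 < u < 4 -> 1 < (1 - u / 6) * (1 + u / 6 + u ^ 2 / 120) ^ 2.
Proof.
intros [u0 u4].
(* The excess over 1 is [u] times a polynomial decreasing on [0, 4], whose value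
   at [4] is positive. *)
assert (E : (1 - u / 6) * (1 + u / 6 + u ^ 2 / 120) ^ 2 - 1
  = u * (1 / 6 - u / 90 - u ^ 2 / 216 - 17 / 43200 * u ^ 3 - u ^ 4 / 86400))
  by field.
assert (u2 : u ^ 2 <= 4 ^ 2) by (apply pow_incr; lra).
assert (u3 : u ^ 3 <= 4 ^ 3) by (apply pow_incr; lra).
assert (u4' : u ^ 4 <= 4 ^ 4) by (apply pow_incr; lra).
enough (0 < u * (1 / 6 - u / 90 - u ^ 2 / 216 - 17 / 43200 * u ^ 3
                 - u ^ 4 / 86400)) by lra.
apply Rmult_lt_0_compat; lra.
Qed.

Lemma cube_lt_sin_mul_sqr_sinh x : 0 < x < 2 -> x ^ 3 < sin x * sinh x ^ 2.
Proof.
intros [x0 x2].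
assert (u4 : 0 < x ^ 2 < 4) by nra.
pose proof (taylor_product_gt_1 (x ^ 2) u4) as prod1.
set (s := x - x ^ 3 / 6); set (h := x + x ^ 3 / 6 + x ^ 5 / 120).
assert (s0 : 0 < s) by (unfold s; nra).
assert (h0 : 0 < h).
  unfold h; pose proof (pow_lt x 3 x0); pose proof (pow_lt x 5 x0); lra.
assert (sh : x ^ 3 < s * h ^ 2).
  replace (s * h ^ 2)
    with (x ^ 3 * ((1 - x ^ 2 / 6) * (1 + x ^ 2 / 6 + (x ^ 2) ^ 2 / 120) ^ 2))
    by (unfold s, h; field).
  pose proof (pow_lt x 3 x0); nra.
apply Rlt_trans with (1 := sh).
apply Rmult_le_0_lt_compat; [lra | apply pow2_ge_0 | |].
- exact (sin_gt_taylor3 x x0).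
- pose proof (sinh_gt_taylor5 x x0 : h < sinh x); nra.
Qed.

(** * The upper bound *)

Lemma sin_mul_sinh_pos x : 0 < x < PI -> 0 < sin x * sinh x.
Proof.
intros [x0 xpi]; apply Rmult_lt_0_compat.
- now apply sin_gt_0.
- pose proof (sinh_gt_id x x0); lra.
Qed.

(** Up to a factor, [1 - cosh x * cos x] is the second derivative of
    [x ^ 2 - sin x * sinh x], and its own second derivative is
    [2 * (sin x * sinh x)]. *)
Lemma cosh_mul_cos_lt_1 x : 0 < x < PI -> cosh x * cos x < 1.
Proof.
intros xpi; apply Rlt_0_minus; revert x xpi.
apply (pos_of_derive_pos (fun t => 1 - cosh t * cos t)
         (fun t => cosh t * sin t - sinh t * cos t)).
- rewrite cosh_0, cos_0; ring.
- intros t; auto_derive; [easy | ring].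
- apply (pos_of_derive_pos (fun t => cosh t * sin t - sinh t * cos t)
           (fun t => 2 * (sin t * sinh t))).
  + rewrite sinh_0, sin_0; ring.
  + intros t; auto_derive; [easy | ring].
  + intros t ht; pose proof (sin_mul_sinh_pos t ht); lra.
Qed.

Lemma sin_mul_sinh_lt_sqr x : 0 < x < PI -> sin x * sinh x < x ^ 2.
Proof.
intros xpi; apply Rlt_0_minus; revert x xpi.
apply (pos_of_derive_pos (fun t => t ^ 2 - sin t * sinh t)
         (fun t => 2 * t - (cos t * sinh t + sin t * cosh t))).
- rewrite sinh_0; ring.
- intros t; auto_derive; [easy | ring].
- apply (pos_of_derive_pos (fun t => 2 * t - (cos t * sinh t + sin t * cosh t))
           (fun t => 2 * (1 - cosh t * cos t))).
  + rewrite sinh_0, sin_0; ring.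
  + intros t; auto_derive; [easy | ring].
  + intros t ht; pose proof (cosh_mul_cos_lt_1 t ht); lra.
Qed.

Theorem theorem1p3 (x : R) (hx0 : (0 < x)%R) (hx1 : (x < PI / 2)%R) :
  (x ^ 2 / (sinh x) ^ 2 < sin x / x < x / sinh x)%R.
Proof.
assert (sh0 : 0 < sinh x) by (pose proof (sinh_gt_id x hx0); lra).
assert (sh2 : 0 < sinh x ^ 2) by (apply pow_lt; exact sh0).
split.
- assert (x2 : 0 < x < 2) by (pose proof PI_4; lra).
  apply Rlt_0_minus.
  replace (sin x / x - x ^ 2 / sinh x ^ 2)
    with ((sin x * sinh x ^ 2 - x ^ 3) / (x * sinh x ^ 2)) by (field; lra).
  apply Rdiv_lt_0_compat.
  + pose proof (cube_lt_sin_mul_sqr_sinh x x2); lra.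
  + now apply Rmult_lt_0_compat.
- assert (xpi : 0 < x < PI) by lra.
  apply Rlt_0_minus.
  replace (x / sinh x - sin x / x)
    with ((x ^ 2 - sin x * sinh x) / (x * sinh x)) by (field; lra).
  apply Rdiv_lt_0_compat.
  + pose proof (sin_mul_sinh_lt_sqr x xpi); lra.
  + now apply Rmult_lt_0_compat.
Qed.
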